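(* For each $i=1,2,3$ let $G_i$ and $H_i$ be $\mathcal L$-cospectral regular graphs (not necessarily non-isomorphic). Then (1) $G_1^S\bowtie(G_2^V\cup G_3^E)$ and $H_1^S\bowtie(H_2^V\cup H_3^E)$ are $\mathcal L$-cospectral graphs; (2) $G_1^S\diamondsuit(G_2^V\cup G_3^E)$ and $H_1^S\diamondsuit(H_2^V\cup H_3^E)$ are $\mathcal L$-cospectral graphs.
   Context: All graphs are finite, simple, undirected, and have at least one vertex. The normalized Laplacian matrix of $G$ is $\mathcal L(G)=I-D(G)^{-1/2}A(G)D(G)^{-1/2}$, where $A(G)$ is the adjacency matrix and $D(G)$ the diagonal degree matrix; rows and columns of $\mathcal L(G)$ indexed by isolated vertices are taken to be zero (e.g. $\mathcal L(K_1)=(0)$). Two graphs $G$ and $H$ are $\mathcal L$-cospectral if $\det(xI-\mathcal L(G))=\det(xI-\mathcal L(H))$. The subdivision graph $S(G_1)$ is obtained by inserting a new vertex into every edge of $G_1$; its vertex set is $V(G_1)\cup I(G_1)$, where $I(G_1)$ is the set of inserted vertices, in bijection with the edges of $G_1$. The graph $G_1^S\bowtie(G_2^V\cup G_3^E)$ (subdivision vertex-edge neighbourhood vertex-corona) consists of $S(G_1)$, $|V(G_1)|$ copies of $G_2$ and $|I(G_1)|$ copies of $G_3$, all vertex-disjoint, where for each $i$ every neighbour in $S(G_1)$ of the $i$-th vertex of $V(G_1)$ is joined to every vertex of the $i$-th copy of $G_2$, and for each $i$ the $i$-th vertex of $I(G_1)$ is joined to every vertex of the $i$-th copy of $G_3$.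 The graph $G_1^S\diamondsuit(G_2^V\cup G_3^E)$ (subdivision vertex-edge neighbourhood edge-corona) consists of $S(G_1)$, $|I(G_1)|$ copies of $G_2$ and $|V(G_1)|$ copies of $G_3$, all vertex-disjoint, where for each $i$ every neighbour in $S(G_1)$ of the $i$-th vertex of $I(G_1)$ is joined to every vertex of the $i$-th copy of $G_2$, and for each $i$ the $i$-th vertex of $V(G_1)$ is joined to every vertex of the $i$-th copy of $G_3$. *)

(* Defs.v *)
From mathcomp Require Import all_boot all_order all_algebra.

Set Implicit Arguments.
Unset Strict Implicit.
Unset Printing Implicit Defensive.

Import GRing.Theory Num.Theory.

Record sgraph := SGraph {
  vertex :> finType;
  adj : rel vertex;
  adj_sym : symmetric adj;
  adj_irrefl : irreflexive adj;
  vertex_gt0 : 0 < #|vertex|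
}.

Definition degree (G : sgraph) (x : G) : nat := #|[set y | adj x y]|.

Definition regular (G : sgraph) : Prop :=
  exists r : nat, forall x : G, degree x = r.

Section Laplacian.

Variable R : rcfType.
Local Open Scope ring_scope.

Definition adj_mx (G : sgraph) : 'M[R]_#|G| :=
  \matrix_(i, j) (adj (enum_val i) (enum_val j))%:R.

(* The entry at an isolated vertex is 0, because 0^-1 = 0; [norm_laplacian]
   zeroes its row and column anyway. *)
Definition deg_inv_sqrt (G : sgraph) : 'M[R]_#|G| :=
  diag_mx (\row_i (Num.sqrt (degree (enum_val i))%:R)^-1).

Definition norm_laplacian (G : sgraph) : 'M[R]_#|G| :=
  \matrix_(i, j)
    if (degree (enum_val i) == 0%N) || (degree (enum_val j) == 0%N) then 0
    else (1%:M - deg_inv_sqrt G *m adj_mx G *m deg_inv_sqrt G) i j.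

Definition L_cospectral (G H : sgraph) : Prop :=
  char_poly (norm_laplacian G) = char_poly (norm_laplacian H).

End Laplacian.

Definition edges (G : sgraph) : {set {set G}} :=
  [set [set p.1; p.2] | p : G * G & adj p.1 p.2].

Definition edge_of (G : sgraph) : finType := {a : {set G} | a \in edges G}.

Section Subdivision.

Variable G : sgraph.

(* [inl v] is an original vertex, [inr a] the vertex inserted in the edge a. *)
Definition subdivision_adj : rel (G + edge_of G) := fun x y =>
  match x, y with
  | inl v, inr a | inr a, inl v => v \in val a
  | _, _ => false
  end.

Fact subdivision_sym : symmetric subdivision_adj.
Proof. by move=> [v|a] [w|b]. Qed.

Fact subdivision_irrefl : irreflexive subdivision_adj.
Proof. by case. Qed.

Fact subdivision_gt0 : 0 < #|{: G + edge_of G}|.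
Proof. by rewrite card_sum addn_gt0 vertex_gt0. Qed.

Definition subdivision : sgraph :=
  SGraph subdivision_sym subdivision_irrefl subdivision_gt0.

End Subdivision.

Section Coronas.

Variables G1 G2 G3 : sgraph.

(* In both coronas, (i, u) is the vertex u of the i-th copy of G2 or G3. *)

Definition vertex_corona_adj :
    rel (subdivision G1 + (G1 * G2 + edge_of G1 * G3)) := fun x y =>
  match x, y with
  | inl s, inl t => adj s t
  | inl s, inr (inl (i, _)) | inr (inl (i, _)), inl s =>
      @adj (subdivision G1) (inl i) s
  | inl s, inr (inr (i, _)) | inr (inr (i, _)), inl s => s == inr i
  | inr (inl (i, u)), inr (inl (j, v)) => (i == j) && adj u v
  | inr (inr (i, u)), inr (inr (j, v)) => (i == j) && adj u v
  | _, _ => false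
  end.

Fact vertex_corona_sym : symmetric vertex_corona_adj.
Proof.
by move=> [s|[[i u]|[i u]]] [t|[[j v]|[j v]]] //=;
  rewrite (adj_sym, subdivision_sym) // eq_sym.
Qed.

Fact vertex_corona_irrefl : irreflexive vertex_corona_adj.
Proof.
by move=> [s|[[i u]|[i u]]] /=;
  rewrite ?(adj_irrefl, subdivision_irrefl) ?andbF.
Qed.

Fact vertex_corona_gt0 :
  0 < #|{: subdivision G1 + (G1 * G2 + edge_of G1 * G3)}|.
Proof. by rewrite card_sum addn_gt0 vertex_gt0. Qed.

Definition vertex_corona : sgraph :=
  SGraph vertex_corona_sym vertex_corona_irrefl vertex_corona_gt0.

Definition edge_corona_adj :
    rel (subdivision G1 + (edge_of G1 * G2 + G1 * G3)) := fun x y =>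
  match x, y with
  | inl s, inl t => adj s t
  | inl s, inr (inl (i, _)) | inr (inl (i, _)), inl s =>
      @adj (subdivision G1) (inr i) s
  | inl s, inr (inr (i, _)) | inr (inr (i, _)), inl s => s == inl i
  | inr (inl (i, u)), inr (inl (j, v)) => (i == j) && adj u v
  | inr (inr (i, u)), inr (inr (j, v)) => (i == j) && adj u v
  | _, _ => false
  end.

Fact edge_corona_sym : symmetric edge_corona_adj.
Proof.
by move=> [s|[[i u]|[i u]]] [t|[[j v]|[j v]]] //=;
  rewrite (adj_sym, subdivision_sym) // eq_sym.
Qed.

Fact edge_corona_irrefl : irreflexive edge_corona_adj.
Proof.
by move=> [s|[[i u]|[i u]]] /=;
  rewrite ?(adj_irrefl, subdivision_irrefl) ?andbF.
Qed.

Fact edge_corona_gt0 :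
  0 < #|{: subdivision G1 + (edge_of G1 * G2 + G1 * G3)}|.
Proof. by rewrite card_sum addn_gt0 vertex_gt0. Qed.

Definition edge_corona : sgraph :=
  SGraph edge_corona_sym edge_corona_irrefl edge_corona_gt0.

End Coronas.

(* Main.v *)
Require Import Defs.
From mathcomp Require Import all_boot all_order fingroup perm all_algebra.
From mathcomp Require Import ring lra.

(** Both coronas are one construction.  Let [inc] be the incidence relation
between vertices and edges of [G1], read in either direction as a relation
between two types [P] and [Q].  Take a bipartite graph on [Q + P], attach to
every [p : P] a copy of [G2] joined to the neighbours of [p], and to every
[q : Q] a copy of [G3] joined to [q].  The vertex corona has [P] = vertices
and [Q] = edges; the edge corona has them exchanged ([is_corona]).

When [G1], [G2], [G3] are regular, the degree of a vertex of the corona depends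
only on its kind, so [x%:M - L] is a block matrix with few distinct scalars.
A copy of [G2] or [G3] meets the rest of the graph only through the all-ones
vector, an eigenvector of its diagonal block, so Schur complements eliminate
the copies ([det_corona]), and then [P], whose diagonal block is scalar.  What
is left ([char_poly_corona]) is a product of powers of determinants of matrices
[a%:M + b *: L] with [L] the Laplacian of [G2] or [G3], and of the determinant
of [beta%:M - gamma *: (C^T *m C)] with [C] the biadjacency matrix of [inc].
The scalars depend only on [x] and on the orders and degrees of the graphs.
With [P] = edges, [C^T *m C] is the matrix [r + A = r (2 - L)] of [G1]
([incidence_gram]); with [P] = vertices, exchanging the two factors costs only
a power of [beta] ([det_1subC]).  Hence every factor is a determinant
[\det (a%:M + b *: L)], a function of the characteristic polynomial of [L]
([det_pencil_char_poly]).

The orders and degrees are functions of the spectra too: the order is the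
degree of the characteristic polynomial, and for a regular graph of order [n]
and degree [r] the trace of [L *m L] is [n * (1 + 1 / r)] if [r > 0], and 0 if not
([L_cospectral_regular]); the number of edges follows by double counting.

The divisions are harmless because everything is done at a fixed [x > 2], where
all the denominators are nonzero; such values determine a polynomial
([poly_eq_above]). *)

Set Implicit Arguments.
Unset Strict Implicit.
Unset Printing Implicit Defensive.

Import Order.TTheory GRing.Theory Num.Theory.

(** * Sums and determinants indexed by finite types *)

Lemma big_pair (T : Type) (idx : T) (op : Monoid.com_law idx) (I J : finType)
    (F : I * J -> T) :
  \big[op/idx]_x F x = \big[op/idx]_i \big[op/idx]_j F (i, j).
Proof. by rewrite pair_bigA /=; apply: eq_bigr => -[]. Qed.

Lemma sum_delta (R : pzRingType) (I : finType) (i : I) (F : I -> R) :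
  (\sum_j (i == j)%:R * F j = F i)%R.
Proof.
rewrite (bigD1 i) //= eqxx mul1r big1 ?addr0 // => j ji.
by rewrite eq_sym (negPf ji) mul0r.
Qed.

Lemma sum_nat_delta (I : finType) (i : I) (F : I -> bool) :
  \sum_j ((i == j) && F j : nat) = F i.
Proof.
rewrite (bigD1 i) //= eqxx big1 ?addn0 // => j /negPf.
by rewrite eq_sym => ->.
Qed.

Lemma inl_eqE (S T : eqType) (x y : S) : (inl x == inl y :> S + T) = (x == y).
Proof. by []. Qed.

Lemma inr_eqE (S T : eqType) (x y : T) : (inr x == inr y :> S + T) = (x == y).
Proof. by []. Qed.

Section Determinants.

Variable R : fieldType.
Local Open Scope ring_scope.

Lemma det_mxsub_bij m n (h : 'I_m -> 'I_n) (A : 'M[R]_n) :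
  bijective h -> \det (mxsub h h A) = \det A.
Proof.
move=> bij_h; have eq_mn: m = n by have:= bij_eq_card bij_h; rewrite !card_ord.
case: _ / eq_mn in h A bij_h *.
pose s := perm (bij_inj bij_h).
have -> : mxsub h h A = row_perm s (col_perm s A).
  by apply/matrixP=> i j; rewrite !mxE !permE.
rewrite row_permE col_permE !det_mulmx !det_perm mulrCA odd_permV.
by rewrite -expr2 sqrr_sign mulr1.
Qed.

(** The solution [X] of [D *m X = C] replaces [D^-1 *m C]: [D] may be singular,
and in the applications [X] is given explicitly. *)
Lemma det_schur m n (A : 'M[R]_m) (B : 'M_(m, n)) (C : 'M_(n, m)) D X :
  D *m X = C -> \det (block_mx A B C D) = \det (A - B *m X) * \det D.
Proof.
move=> DX; have <- : \det (block_mx A B C D *m block_mx 1%:M 0 (- X) 1%:M) =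
    \det (block_mx A B C D).
  by rewrite det_mulmx det_lblock !det1 !mulr1.
rewrite mulmx_block !mulmx1 !mulmx0 !add0r !mulmxN DX subrr.
by rewrite det_ublock.
Qed.

(** Sylvester's determinant identity: both sides are [c ^+ n] times the determinant
of [block_mx c (d A) B 1], computed by eliminating one or the other of its diagonal
blocks. *)
Lemma det_1subC m n (c d : R) (A : 'M[R]_(m, n)) (B : 'M_(n, m)) : c != 0 ->
  \det (c%:M - d *: (A *m B)) * c ^+ n = \det (c%:M - d *: (B *m A)) * c ^+ m.
Proof.
move=> c0; pose M := block_mx c%:M (d *: A) B (1%:M : 'M_n).
have: \det M = \det (c%:M - d *: (A *m B)).
  by rewrite /M (@det_schur _ _ _ _ _ _ B) ?mul1mx // det1 mulr1 scalemxAl.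
move=> <-.
have -> : \det M * c ^+ n = \det (M *m block_mx 1%:M (- (d *: A)) 0 c%:M).
  by rewrite det_mulmx det_ublock det1 mul1r det_scalar.
rewrite /M mulmx_block !mulmx1 !mulmx0 !addr0 mul1mx.
rewrite mul_scalar_mx mul_mx_scalar scalerN addNr det_lblock det_scalar mulrC.
by rewrite mulmxN addrC -scalemxAr.
Qed.

(** Matrices with rows and columns labelled by finite types.  The determinant does
not depend on the enumeration, and so may be computed along any bijection. *)
Definition fmx (S T : finType) (F : S -> T -> R) : 'M[R]_(#|S|, #|T|) :=
  \matrix_(i, j) F (enum_val i) (enum_val j).

Lemma eq_fmx (S T : finType) (F G : S -> T -> R) : F =2 G -> fmx F = fmx G.
Proof. by move=> eqFG; apply/matrixP=> i j; rewrite !mxE eqFG. Qed.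

Lemma fmx_mul (S T U : finType) (F : S -> T -> R) (G : T -> U -> R) :
  fmx F *m fmx G = fmx (fun s u => \sum_t F s t * G t u).
Proof.
apply/matrixP=> i j; rewrite !mxE.
rewrite (reindex (enum_val : 'I_#|T| -> T)) /=; last exact/onW_bij/enum_val_bij.
by apply: eq_bigr => k _; rewrite !mxE.
Qed.

Lemma fmx_scalar (S : finType) (a : R) :
  a%:M = fmx (fun s t : S => a * (s == t)%:R).
Proof. by apply/matrixP=> i j; rewrite !mxE (inj_eq enum_val_inj) mulr_natr. Qed.

Lemma det_fmx_bij (S T : finType) (e : S -> T) (F : T -> T -> R) :
  bijective e -> \det (fmx (fun s t => F (e s) (e t))) = \det (fmx F).
Proof.
move=> bij_e; pose h (i : 'I_#|S|) : 'I_#|T| := enum_rank (e (enum_val i)).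
rewrite -(@det_mxsub_bij _ _ h (fmx F)); last first.
  by apply: (bij_comp (@enum_rank_bij _)); apply: (bij_comp bij_e (@enum_val_bij _)).
by congr (\det _); apply/matrixP=> i j; rewrite !mxE !enum_rankK.
Qed.

Lemma det_fmx_sum (S T : finType) (F : S + T -> S + T -> R) :
  \det (fmx F) = \det (block_mx
    (fmx (fun s s' => F (inl s) (inl s'))) (fmx (fun s t => F (inl s) (inr t)))
    (fmx (fun t s => F (inr t) (inl s))) (fmx (fun t t' => F (inr t) (inr t')))).
Proof.
pose g (i : 'I_(#|S| + #|T|)) : S + T :=
  match split i with inl j => inl (enum_val j) | inr k => inr (enum_val k) end.
pose h i : 'I_#|{: S + T}| := enum_rank (g i).
rewrite -(@det_mxsub_bij _ _ h (fmx F)); last first.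
  apply: (bij_comp (@enum_rank_bij _)).
  exists (fun x => match x with inl s => lshift _ (enum_rank s)
                            | inr t => rshift _ (enum_rank t) end).
    by move=> i; rewrite /g -[RHS]splitK; case: (split i) => j; rewrite enum_valK.
  by rewrite /g => -[s|t]; rewrite -?[split (lshift _ _)]/(split (unsplit (inl _)))
    -?[split (rshift _ _)]/(split (unsplit (inr _))) unsplitK enum_rankK.
congr (\det _); apply/matrixP=> i j; rewrite !mxE !enum_rankK /g.
by case: (split i) => ?; rewrite ?mxE; case: (split j) => ?; rewrite ?mxE.
Qed.

(** This is the determinant of the Kronecker product of an identity matrix with
[F]: one copy of [F] is split off at a time. *)
Lemma det_fmx_prod (S T : finType) (F : T -> T -> R) :
  \det (fmx (fun p q : S * T => (p.1 == q.1)%:R * F p.2 q.2))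
    = \det (fmx F) ^+ #|S|.
Proof.
pose e (p : 'I_#|S| * T) : S * T := (enum_val p.1, p.2).
rewrite -(@det_fmx_bij _ _ e); last first.
  exists (fun p => (enum_rank p.1, p.2)) => -[i t]; rewrite /e ?enum_valK //.
  by rewrite enum_rankK.
rewrite /e /=; under eq_fmx do rewrite (inj_eq enum_val_inj).
elim: {S e}#|S| => [|n IHn].
  rewrite expr0; have: #|{: 'I_0 * T}| = 0%N by rewrite card_prod card_ord.
  by move: (fmx _) => /= A c0; case: _ / (esym c0) in A *; rewrite det_mx00.
pose f (x : T + 'I_n * T) : 'I_n.+1 * T :=
  match x with inl t => (ord0, t) | inr p => (lift ord0 p.1, p.2) end.
rewrite -(@det_fmx_bij _ _ f); last first.
  exists (fun p => if unlift ord0 p.1 is Some i then inr (i, p.2) else inl p.2).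
    by case=> [t|[i t]]; rewrite /f /= ?unlift_none ?liftK.
  by case=> i t; case: (unliftP ord0 i) => [j|] /= ->.
rewrite det_fmx_sum /f /= [X in block_mx _ X]( _ : _ = 0); last first.
  by apply/matrixP=> i j; rewrite !mxE /= mul0r.
rewrite (det_lblock (fmx _) (fmx _)) exprS -IHn; congr (\det _ * _).
by apply: eq_fmx => s t; rewrite mul1r.
Qed.

End Determinants.

(** * Eliminating the copies *)

Section CoronaDeterminant.

Variable R : fieldType.
Local Open Scope ring_scope.

Variables (P Q U W : finType) (C : P -> Q -> R) (M2 : U -> U -> R) (M3 : W -> W -> R).
Variables (alpha beta c a2 a3 mu2 mu3 : R).

(** The shape of [x%:M - L] for a corona: one scalar for each kind of diagonal
entry or of edge, and one diagonal block for each copy. *)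
Definition corona_entry (s t : (Q + P) + (P * U + Q * W)) : R :=
  match s, t with
  | inl (inl q), inl (inl q') => beta * (q == q')%:R
  | inl (inr p), inl (inr p') => alpha * (p == p')%:R
  | inl (inl q), inl (inr p) | inl (inr p), inl (inl q) => c * C p q
  | inl (inl q), inr (inl (p, _)) | inr (inl (p, _)), inl (inl q) => a2 * C p q
  | inl (inl q), inr (inr (q', _)) | inr (inr (q', _)), inl (inl q) =>
      a3 * (q == q')%:R
  | inr (inl (p, u)), inr (inl (p', u')) => (p == p')%:R * M2 u u'
  | inr (inr (q, w)), inr (inr (q', w')) => (q == q')%:R * M3 w w'
  | _, _ => 0
  end.

Hypotheses (row2 : forall u, \sum_v M2 u v = mu2)
           (row3 : forall w, \sum_v M3 w v = mu3).
Hypotheses (alpha0 : alpha != 0) (mu20 : mu2 != 0) (mu30 : mu3 != 0).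

Definition copies_entry (s t : P * U + Q * W) : R := corona_entry (inr s) (inr t).

(** The solution of [D *m X = C], where [D] is the block of the copies and [C] the
block that joins them to [Q + P]: on a copy, [C] is a multiple of the all-ones
vector, which [D] multiplies by [mu2] or [mu3]. *)
Definition elim_entry (s : P * U + Q * W) (t : Q + P) : R :=
  match s, t with
  | inl (p, _), inl q => a2 / mu2 * C p q
  | inr (q', _), inl q => a3 / mu3 * (q == q')%:R
  | _, _ => 0
  end.

(** Eliminating the copies leaves a matrix on [Q + P] in which only the [Q] block
has changed; its [P] block is the scalar [alpha], which is eliminated next. *)
Lemma det_corona :
  \det (fmx corona_entry) =
    \det (fmx M2) ^+ #|P| * \det (fmx M3) ^+ #|Q| * alpha ^+ #|P| *
    \det ((beta - a3 ^+ 2 * #|W|%:R / mu3)%:M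
          - (a2 ^+ 2 * #|U|%:R / mu2 + c ^+ 2 / alpha) *:
            (fmx (fun q p => C p q) *m fmx C)).
Proof.
rewrite det_fmx_sum (@det_schur _ _ _ _ _ _ _ (fmx elim_entry)); last first.
  rewrite fmx_mul; apply: eq_fmx => -[[p u]|[q w]] [q'|p'] /=;
    rewrite big_sumType /=.
  - rewrite [X in _ + X]big1 ?addr0; last by case=> ? ? _; rewrite mul0r.
    rewrite big_pair /=.
    under eq_bigr => p' _.
      rewrite -mulr_suml -mulr_sumr row2 -mulrA.
    over.
    by rewrite sum_delta mulrA [mu2 * _]mulrC divfK.
  - by rewrite !big1 ?addr0 // => -[? ?] _; rewrite ?mul0r ?mulr0.
  - rewrite [X in X + _]big1 ?add0r; last by case=> ? ? _; rewrite mul0r.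
    rewrite big_pair /=.
    under eq_bigr => q1 _.
      rewrite -mulr_suml -mulr_sumr row3 -mulrA.
    over.
    by rewrite sum_delta mulrA [mu3 * _]mulrC divfK.
  - by rewrite !big1 ?addr0 // => -[? ?] _; rewrite ?mul0r ?mulr0.
have -> : \det (fmx copies_entry) = \det (fmx M2) ^+ #|P| * \det (fmx M3) ^+ #|Q|.
  rewrite det_fmx_sum /copies_entry /=.
  rewrite [X in block_mx _ X](_ : _ = 0); last first.
    by apply/matrixP=> i j; rewrite !mxE; case: (enum_val i) (enum_val j) => ? ? [? ?].
  rewrite (det_lblock (fmx _) (fmx _)) -!det_fmx_prod.
  by congr (_ * _); congr (\det _); apply: eq_fmx => -[? ?] [? ?].
rewrite mulrC -[RHS]mulrA; congr (_ * _).
pose K q q' := beta * (q == q')%:R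
  - (a2 ^+ 2 * #|U|%:R / mu2 * (\sum_p C p q * C p q')
     + a3 ^+ 2 * #|W|%:R / mu3 * (q == q')%:R).
pose E (s t : Q + P) : R :=
  match s, t with
  | inl q, inl q' => K q q'
  | inr p, inr p' => alpha * (p == p')%:R
  | inl q, inr p | inr p, inl q => c * C p q
  end.
transitivity (\det (fmx E)).
  congr (\det _); rewrite fmx_mul; apply/matrixP=> i j; rewrite !mxE.
  case: (enum_val i) (enum_val j) => [q|p] [q'|p'] /=;
    rewrite big_sumType !big_pair /=.
  - congr (_ - (_ + _)).
      rewrite mulr_sumr; apply: eq_bigr => p _.
      by rewrite sumr_const -mulr_natr; ring.
    rewrite (eq_bigr (fun q1 => (q == q1)%:R *
               (a3 ^+ 2 * #|W|%:R / mu3 * (q1 == q')%:R))).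
      by rewrite sum_delta.
    move=> q1 _; rewrite sumr_const [q' == q1]eq_sym -mulr_natr; ring.
  - by rewrite !big1 ?addr0 ?subr0 // => *; rewrite big1 // => *; rewrite mulr0.
  - by rewrite !big1 ?addr0 ?subr0 // => *; rewrite ?mul0r // big1 // => *; rewrite mul0r.
  - by rewrite !big1 ?addr0 ?subr0 // => *; rewrite ?mul0r // big1 // => *; rewrite mul0r.
rewrite det_fmx_sum /= (@det_schur _ _ _ _ _ _ _ (c / alpha *: fmx C)); last first.
  rewrite -fmx_scalar mul_scalar_mx scalerA mulrC divfK //.
  by apply/matrixP=> i j; rewrite !mxE.
rewrite -fmx_scalar det_scalar mulrC; congr (_ * \det _).
rewrite -scalemxAr !fmx_mul; apply/matrixP=> i j; rewrite !mxE.
rewrite /K (inj_eq enum_val_inj) -[_ *+ (i == j)]mulr_natr.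
under [X in c / alpha * X]eq_bigr do rewrite -mulrA.
rewrite -mulr_sumr; ring.
Qed.

End CoronaDeterminant.

(** * What the characteristic polynomial determines *)

Section CharPoly.

Local Open Scope ring_scope.

Lemma horner_char_poly (R : comNzRingType) n (A : 'M[R]_n) x :
  (char_poly A).[x] = \det (x%:M - A).
Proof.
rewrite -horner_evalE -det_map_mx; congr (\det _).
by apply/matrixP=> i j; rewrite !mxE /= /horner_eval !(hornerE, hornerMn).
Qed.

(** The difference of the polynomials vanishes at infinitely many points. *)
Lemma poly_eq_above (R : realFieldType) (p q : {poly R}) a :
  (forall x, a < x -> p.[x] = q.[x]) -> p = q.
Proof.
move=> eq_pq; apply/eqP; rewrite -subr_eq0; apply/eqP.
pose f (k : nat) : R := `|a| + 1 + k%:R.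
apply: (@roots_geq_poly_eq0 _ _ [seq f k | k <- iota 0 (size (p - q))]).
- apply/allP=> _ /mapP[k _ ->]; rewrite /root !hornerE eq_pq ?subrr //.
  by rewrite /f -addrA (le_lt_trans (ler_norm a)) // ltrDl ltr_pwDl // ler0n.
- rewrite map_inj_uniq ?iota_uniq // => k l /addrI/eqP.
  by rewrite eqr_nat => /eqP.
- by rewrite size_map size_iota.
Qed.

Lemma char_poly_dim (R : nzRingType) m n (A : 'M[R]_m) (B : 'M[R]_n) :
  char_poly A = char_poly B -> m = n.
Proof. by move/(congr1 (size : {poly R} -> nat)); rewrite !size_char_poly => -[]. Qed.

(** For [b != 0] this is [(- b) ^+ n] times the value of the characteristic
polynomial at [- a / b]. *)
Lemma det_pencil_char_poly (R : fieldType) m n (A : 'M[R]_m) (B : 'M[R]_n) a b :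
  char_poly A = char_poly B -> \det (a%:M + b *: A) = \det (a%:M + b *: B).
Proof.
move=> eqAB; have eq_mn := char_poly_dim eqAB.
case: _ / eq_mn in B eqAB *.
have [->|b0] := eqVneq b 0; first by rewrite !scale0r.
have pencil (M : 'M[R]_m) : a%:M + b *: M = - b *: ((- a / b)%:M - M).
  by rewrite scalerBr scale_scalar_mx scaleNr opprK; congr (_%:M + _); field.
by rewrite !pencil !detZ -!horner_char_poly eqAB.
Qed.

(** At [y ^+ 2], the characteristic polynomial of [A *m A] is the determinant of
[(y - A) (y + A)]; every positive number has a square root. *)
Lemma char_poly_sqr (R : rcfType) m n (A : 'M[R]_m) (B : 'M[R]_n) :
  char_poly A = char_poly B -> char_poly (A *m A) = char_poly (B *m B).
Proof.
move=> eqAB; apply: (@poly_eq_above _ _ _ 0) => x /ltW x0.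
rewrite -(sqr_sqrtr x0); set y := Num.sqrt x; rewrite !horner_char_poly.
have factor k (M : 'M[R]_k) :
    (y ^+ 2)%:M - M *m M = (y%:M + (-1) *: M) *m (y%:M + 1 *: M).
  rewrite scaleN1r scale1r mulmxBl !mulmxDr -scalar_mxM -expr2.
  by rewrite mul_scalar_mx mul_mx_scalar opprD addrA addrK.
by rewrite !factor !det_mulmx !(det_pencil_char_poly _ _ eqAB).
Qed.

Lemma trace_sqr_char_poly (R : rcfType) m n (A : 'M[R]_m) (B : 'M[R]_n) :
  char_poly A = char_poly B -> \tr (A *m A) = \tr (B *m B).
Proof.
move=> eqAB; have eqAB2 := char_poly_sqr eqAB.
have eq_mn := char_poly_dim eqAB.
case: _ / eq_mn in B eqAB eqAB2 *.
case: m => [|m] in A B eqAB eqAB2 *; first by rewrite /mxtrace !big_ord0.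
by apply: oppr_inj; rewrite -!char_poly_trace // eqAB2.
Qed.

End CharPoly.

(** * Laplacians of regular graphs *)

Section LaplacianOfRegular.

Variable R : rcfType.
Local Open Scope ring_scope.

Definition inv_sqrt (d : nat) : R := (Num.sqrt d%:R)^-1.
Definition nonzero (d : nat) : R := (d != 0%N)%:R.

Lemma inv_sqrt_sqr d : inv_sqrt d ^+ 2 = d%:R^-1.
Proof. by rewrite exprVn sqr_sqrtr. Qed.

(** The convention at isolated vertices costs only a zero on the diagonal: off the
diagonal [inv_sqrt] vanishes by itself. *)
Lemma norm_laplacianE (G : sgraph) :
  norm_laplacian R G = fmx (fun x y : G =>
    nonzero (degree x) * (x == y)%:R
    - inv_sqrt (degree x) * inv_sqrt (degree y) * (adj x y)%:R).
Proof.
rewrite /norm_laplacian /deg_inv_sqrt mul_diag_mx mul_mx_diag.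
apply/matrixP=> i j; rewrite !mxE (inj_eq enum_val_inj) /nonzero /inv_sqrt.
have [->|x0] /= := eqVneq (degree _) 0%N.
  by rewrite sqrtr0 invr0 !mul0r subr0.
have [y0|y0] /= := eqVneq (degree (enum_val j)) 0%N; last first.
  by rewrite mul1r [_ * _ * (adj _ _)%:R]mulrAC.
rewrite y0 sqrtr0 invr0 mulr0 mul0r subr0 mul1r.
by case: eqP => // eq_ij; rewrite eq_ij y0 in x0.
Qed.

Lemma degreeE (G : sgraph) (x : G) : degree x = (\sum_y adj x y)%N.
Proof.
rewrite /degree -sum1_card big_mkcond /=.
by apply: eq_bigr => y _; rewrite inE; case: (adj x y).
Qed.

Lemma sum_adj (G : sgraph) (x : G) : \sum_y (adj x y)%:R = (degree x)%:R :> R.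
Proof. by rewrite degreeE natr_sum. Qed.

Section Regular.

Variables (G : sgraph) (r : nat).
Hypothesis regG : forall x : G, degree x = r.

Lemma norm_laplacian_regular :
  norm_laplacian R G = (nonzero r)%:M - r%:R^-1 *: fmx (fun x y : G => (adj x y)%:R).
Proof.
rewrite norm_laplacianE (fmx_scalar G); apply/matrixP=> i j.
by rewrite !mxE !regG -inv_sqrt_sqr expr2.
Qed.

(** In degree 0 both sides vanish. *)
Lemma adj_mx_regular :
  fmx (fun x y : G => (adj x y)%:R : R) = r%:R%:M - r%:R *: norm_laplacian R G.
Proof.
rewrite norm_laplacian_regular scalerBr scale_scalar_mx scalerA opprB addrC.
have [r0|r0] := eqVneq r 0%N; last first.
  by rewrite /nonzero r0 mulr1 mulfV ?pnatr_eq0 // scale1r subrK.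
rewrite r0 !mul0r scale0r sub0r addNr; apply/matrixP=> i j; rewrite !mxE.
have := regG (enum_val i); rewrite r0 degreeE => /eqP.
by rewrite sum_nat_eq0 => /forallP/(_ (enum_val j)) /eqP ->.
Qed.

Lemma trace_sqr_laplacian :
  \tr (norm_laplacian R G *m norm_laplacian R G) = #|G|%:R * (nonzero r + r%:R^-1).
Proof.
rewrite norm_laplacianE fmx_mul /mxtrace.
rewrite (eq_bigr (fun=> nonzero r + r%:R^-1)) ?sumr_const ?card_ord ?mulr_natl // => i _.
rewrite mxE; set s := enum_val i.
rewrite (eq_bigr (fun t =>
  nonzero r * ((s == t)%:R * 1) + (r%:R^-1) ^+ 2 * (adj s t)%:R)).
  rewrite big_split /= -!mulr_sumr sum_delta sum_adj regG mulr1.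
  have [->|r0] := eqVneq r 0%N; first by rewrite invr0 mulr0.
  by rewrite expr2 -mulrA mulVf ?pnatr_eq0 // mulr1.
move=> t _; rewrite !regG -!expr2 -inv_sqrt_sqr eq_sym (adj_sym t s) /nonzero.
have [<-|] := eqVneq s t; first by rewrite adj_irrefl; case: (r != _) => /=; ring.
by case: (adj s t) => _ /=; ring.
Qed.

End Regular.

(** The values are 0 at 0, and [1 + 1 / r > 0] elsewhere. *)
Lemma nonzero_inv_inj : injective (fun r : nat => nonzero r + r%:R^-1).
Proof.
have pos r : 0 < 1 + r%:R^-1 :> R by rewrite ltr_pwDl ?invr_ge0.
move=> [|r] [|s] //=; rewrite /nonzero /= ?invr0 ?addr0 => eq_rs.
- by have:= pos s.+1; rewrite -eq_rs ltxx.
- by have:= pos r.+1; rewrite eq_rs ltxx.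
- by move/addrI/invr_inj/eqP: eq_rs; rewrite eqr_nat => /eqP.
Qed.

(** Comparing the traces of the squares of the Laplacians shows that the
degrees agree. *)
Lemma L_cospectral_regular (G H : sgraph) r s :
  (forall x : G, degree x = r) -> (forall x : H, degree x = s) ->
  L_cospectral R G H -> #|G| = #|H| /\ r = s.
Proof.
move=> regG regH cosp; have eq_n := char_poly_dim cosp; split=> //.
have := trace_sqr_char_poly cosp.
rewrite (trace_sqr_laplacian regG) (trace_sqr_laplacian regH) eq_n.
by move/mulfI => /(_ _)/nonzero_inv_inj-> //; rewrite pnatr_eq0 -lt0n vertex_gt0.
Qed.

End LaplacianOfRegular.

(** * Coronas of a biregular incidence relation *)

(** The [q]'s come first so that the [p]'s, whose diagonal block is scalar, form
the lower right block, the one that a Schur complement removes. *)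
Definition corona_adj (P Q : finType) (inc : P -> Q -> bool) (G2 G3 : sgraph) :
    rel ((Q + P) + (P * G2 + Q * G3)) := fun s t =>
  match s, t with
  | inl (inl q), inl (inr p) | inl (inr p), inl (inl q) => inc p q
  | inl (inl q), inr (inl (p, _)) | inr (inl (p, _)), inl (inl q) => inc p q
  | inl (inl q), inr (inr (q', _)) | inr (inr (q', _)), inl (inl q) => q == q'
  | inr (inl (p, u)), inr (inl (p', u')) => (p == p') && adj u u'
  | inr (inr (q, w)), inr (inr (q', w')) => (q == q') && adj w w'
  | _, _ => false
  end.

(** The bijection reconciles the order [Q + P] with that of the subdivision graph,
where vertices precede edges whichever of them play the part of [Q]. *)
Definition is_corona (P Q : finType) (inc : P -> Q -> bool) (G2 G3 X : sgraph) :=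
  exists2 e : (Q + P) + (P * G2 + Q * G3) -> X, bijective e &
    forall s t, adj (e s) (e t) = corona_adj inc s t.

Definition biregular (P Q : finType) (inc : P -> Q -> bool) (dP dQ : nat) :=
  (forall p, \sum_q inc p q = dP) /\ (forall q, \sum_p inc p q = dQ).

Lemma biregular_double_count (P Q : finType) (inc : P -> Q -> bool) dP dQ :
  biregular inc dP dQ -> #|P| * dP = #|Q| * dQ.
Proof.
case=> regP regQ; rewrite -2!sum_nat_const.
rewrite -(eq_bigr _ (fun p _ => regP p)) exchange_big /=.
by apply: eq_bigr => q _; apply: regQ.
Qed.

Definition gram (R : fieldType) (P Q : finType) (inc : P -> Q -> bool) : 'M[R]_#|Q| :=
  fmx (fun q p => (inc p q)%:R)%R *m fmx (fun p q => (inc p q)%:R)%R.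

Section CoronaLaplacian.

Variables (R : rcfType) (P Q : finType) (inc : P -> Q -> bool) (G2 G3 : sgraph).
Variables (dP dQ r2 r3 : nat).
Hypotheses (reg_inc : biregular inc dP dQ).
Hypotheses (reg2 : forall u : G2, degree u = r2) (reg3 : forall w : G3, degree w = r3).
Local Open Scope ring_scope.

(** The degree of [q : Q]: its [dQ] neighbours in [P], the copies of [G2] attached
to them, and its own copy of [G3]. *)
Definition hub_degree (n2 n3 : nat) : nat := (dQ + dQ * n2 + n3)%N.

Definition corona_degree (s : (Q + P) + (P * G2 + Q * G3)) : nat :=
  match s with
  | inl (inl _) => hub_degree #|G2| #|G3|
  | inl (inr _) => dP
  | inr (inl _) => (r2 + dP)%N
  | inr (inr _) => r3.+1
  end.

Lemma sum_corona_adj s : (\sum_t corona_adj inc s t)%N = corona_degree s.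
Proof.
have deg2 (u : G2) : (\sum_v adj u v)%N = r2 by rewrite -degreeE reg2.
have deg3 (u : G3) : (\sum_v adj u v)%N = r3 by rewrite -degreeE reg3.
have [regP regQ] := reg_inc.
case: s => [[q|p]|[[p u]|[q w]]]; rewrite !big_sumType /= !big_pair /=.
- rewrite big1 // add0n regQ /hub_degree -addnA; congr (_ + (_ + _))%N.
    under eq_bigr do rewrite sum_nat_const mulnC.
    by rewrite -big_distrl /= regQ.
  by under eq_bigr do rewrite sum_nat_const -[q == _]andbT mulnC;
    rewrite -big_distrl /= (sum_nat_delta q xpredT) mul1n.
- by rewrite regP !big1 ?addn0 // => i _; rewrite big1.
- rewrite regP [X in (_ + X + _)%N]big1 // addn0.
  rewrite [X in (_ + (_ + X))%N]big1 ?addn0; last by move=> i _; rewrite big1.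
  rewrite addnC; congr (_ + _)%N; rewrite exchange_big /=.
  by under eq_bigr do rewrite (sum_nat_delta p (fun=> adj u _)).
- rewrite [X in (_ + X + _)%N]big1 // addn0.
  rewrite [X in (_ + (X + _))%N]big1 ?add0n; last by move=> i _; rewrite big1.
  rewrite exchange_big /=.
  under [X in (_ + X)%N]eq_bigr do rewrite (sum_nat_delta q (fun=> adj w _)).
  rewrite deg3; under eq_bigr do rewrite eq_sym -[q == _]andbT.
  by rewrite (sum_nat_delta q xpredT).
Qed.

(** The condition [2 < x] ensures that all denominators are positive, and that
[beta] is: [mu3 > 1], and the fraction subtracted in [beta] is at most 1, because
the degree of [q] is at least the order of [G3].  That [beta] is nonzero is needed to exchange [P] and [Q] by [det_1subC]. *)
Lemma char_poly_corona X x : is_corona inc G2 G3 X -> 2 < x ->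
  let k1 := hub_degree #|G2| #|G3| in let k2 := (r2 + dP)%N in
  let alpha := x - nonzero R dP in
  let mu2 := x - nonzero R k2 + inv_sqrt R k2 ^+ 2 * r2%:R in
  let mu3 := x - nonzero R r3.+1 + inv_sqrt R r3.+1 ^+ 2 * r3%:R in
  let beta := x - nonzero R k1
              - (inv_sqrt R k1 * inv_sqrt R r3.+1) ^+ 2 * #|G3|%:R / mu3 in
  let gamma := (inv_sqrt R k1 * inv_sqrt R k2) ^+ 2 * #|G2|%:R / mu2
               + (inv_sqrt R k1 * inv_sqrt R dP) ^+ 2 / alpha in
  beta != 0 /\
  (char_poly (norm_laplacian R X)).[x] =
    \det (mu2%:M + (- (inv_sqrt R k2 ^+ 2 * r2%:R)) *: norm_laplacian R G2) ^+ #|P| *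
    \det (mu3%:M + (- (inv_sqrt R r3.+1 ^+ 2 * r3%:R)) *: norm_laplacian R G3) ^+ #|Q| *
    alpha ^+ #|P| *
    \det (beta%:M - gamma *: gram R inc).
Proof.
move=> [e bij_e adj_e] x2 k1 k2 alpha mu2 mu3 beta gamma.
pose C p q : R := (inc p q)%:R.
have nonzero_le1 d : nonzero R d <= 1 by rewrite /nonzero lern1 leq_b1.
have sqr_inv_sqrt_ge0 d : 0 <= inv_sqrt R d ^+ 2 by rewrite sqr_ge0.
have alpha0 : alpha != 0 by rewrite gt_eqF // /alpha; have := nonzero_le1 dP; lra.
have mu2_gt1 : 1 < mu2.
  have := mulr_ge0 (sqr_inv_sqrt_ge0 k2) (ler0n R r2).
  by have := nonzero_le1 k2; rewrite /mu2; lra.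
have mu3_gt1 : 1 < mu3.
  have := mulr_ge0 (sqr_inv_sqrt_ge0 r3.+1) (ler0n R r3).
  by have := nonzero_le1 r3.+1; rewrite /mu3; lra.
split.
  suff: (inv_sqrt R k1 * inv_sqrt R r3.+1) ^+ 2 * #|G3|%:R / mu3 <= 1.
    by move=> le1; rewrite gt_eqF // /beta; have := nonzero_le1 k1; lra.
  rewrite ler_pdivrMr ?mul1r; last by lra.
  apply: le_trans (ltW mu3_gt1); rewrite exprMn !inv_sqrt_sqr mulrAC.
  have k1_gt0 : 0 < k1%:R :> R by rewrite ltr0n /k1 /hub_degree addn_gt0 vertex_gt0 orbT.
  apply: mulr_ile1; rewrite ?mulr_ge0 ?invr_ge0 ?ler0n //.
    by rewrite mulrC ler_pdivrMr // mul1r ler_nat /k1 /hub_degree leq_addl.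
  by rewrite invf_le1 ?ltr0n // ler1n.
have degE s : degree (e s) = corona_degree s.
  rewrite degreeE (reindex e) /=; last exact: onW_bij.
  by rewrite -sum_corona_adj; apply: eq_bigr => t _; rewrite adj_e.
(* The diagonal block of a copy of [G] whose vertices have degree [k] in [X]. *)
pose M (G : sgraph) k (u v : G) : R :=
  (x - nonzero R k) * (u == v)%:R + inv_sqrt R k ^+ 2 * (adj u v)%:R.
have M_laplacian (G : sgraph) r k : (forall u : G, degree u = r) ->
    fmx (@M G k) = (x - nonzero R k + inv_sqrt R k ^+ 2 * r%:R)%:M
                  + (- (inv_sqrt R k ^+ 2 * r%:R)) *: norm_laplacian R G.
  move=> regG; rewrite raddfD /= -addrA scaleNr -scalerA -scale_scalar_mx -scalerBr.
  rewrite -(adj_mx_regular _ regG) (fmx_scalar G).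
  by apply/matrixP=> i j; rewrite !mxE.
have M_row (G : sgraph) r k (u : G) : (forall u : G, degree u = r) ->
    \sum_v M G k u v = x - nonzero R k + inv_sqrt R k ^+ 2 * r%:R.
  move=> regG; rewrite big_split /= -!mulr_sumr sum_adj regG.
  by under eq_bigr do rewrite -[_%:R]mulr1; rewrite sum_delta mulr1.
rewrite horner_char_poly norm_laplacianE (fmx_scalar X).
rewrite -(M_laplacian G2 r2 k2 reg2) -(M_laplacian G3 r3 r3.+1 reg3).
rewrite -(@det_corona _ _ _ _ _ C (@M G2 k2) (@M G3 r3.+1) alpha (x - nonzero R k1)
  (inv_sqrt R k1 * inv_sqrt R dP) (inv_sqrt R k1 * inv_sqrt R k2)
  (inv_sqrt R k1 * inv_sqrt R r3.+1) mu2 mu3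
  (fun u => M_row G2 r2 k2 u reg2) (fun w => M_row G3 r3 r3.+1 w reg3)) //;
  try by rewrite gt_eqF // (lt_trans ltr01).
have -> (F G : X -> X -> R) : fmx F - fmx G = fmx (fun s t => F s t - G s t).
  by apply/matrixP=> i j; rewrite !mxE.
rewrite -(det_fmx_bij _ bij_e); congr (\det _); apply: eq_fmx => s t.
rewrite !degE !adj_e (inj_eq (bij_inj bij_e)).
case: s t => [[q|p]|[[p u]|[q w]]] [[q'|p']|[[p' u']|[q' w']]] //=.
all: rewrite ?inl_eqE ?inr_eqE ?xpair_eqE /M /C /k1 /k2 /alpha -?mulnb ?natrM /=;
  try ring.
Qed.

End CoronaLaplacian.

Section CospectralCoronas.

Variable R : rcfType.
Local Open Scope ring_scope.

(** The characteristic polynomials agree factor by factor at every [x > 2].  The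
hypothesis on [gram] has [a != 0] so that it can be derived by [det_1subC]. *)
Lemma L_cospectral_corona (P Q P' Q' : finType)
    (inc : P -> Q -> bool) (inc' : P' -> Q' -> bool) (dP dQ : nat)
    (G2 G3 H2 H3 X X' : sgraph) :
  biregular inc dP dQ -> biregular inc' dP dQ -> #|P| = #|P'| -> #|Q| = #|Q'| ->
  regular G2 -> regular H2 -> L_cospectral R G2 H2 ->
  regular G3 -> regular H3 -> L_cospectral R G3 H3 ->
  (forall a b, a != 0 ->
    \det (a%:M - b *: gram R inc) = \det (a%:M - b *: gram R inc')) ->
  is_corona inc G2 G3 X -> is_corona inc' H2 H3 X' -> L_cospectral R X X'.
Proof.
move=> reg_inc reg_inc' eq_P eq_Q [r2 regG2] [s2 regH2] cosp2.
move=> [r3 regG3] [s3 regH3] cosp3 eq_gram corX corX'.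
have [eqn2 eqr2] := L_cospectral_regular regG2 regH2 cosp2.
have [eqn3 eqr3] := L_cospectral_regular regG3 regH3 cosp3.
move: regH2 regH3; rewrite -eqr2 -eqr3 => regH2 regH3.
apply: (@poly_eq_above _ _ _ 2) => x x2.
have [beta0 ->] := char_poly_corona reg_inc regG2 regG3 corX x2.
have [_ ->] := char_poly_corona reg_inc' regH2 regH3 corX' x2.
rewrite eq_gram // (det_pencil_char_poly _ _ cosp2) (det_pencil_char_poly _ _ cosp3).
by rewrite eq_P eq_Q eqn2 eqn3.
Qed.

End CospectralCoronas.

(** * The incidence relation of a regular graph *)

Section Incidence.

Variable G : sgraph.

Definition incident (v : G) (a : edge_of G) : bool := v \in val a.

Lemma in_edges (v w : G) : ([set v; w] \in edges G) = adj v w.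
Proof.
apply/imsetP/idP => [[[p q] pq /= eq_vw]|vw]; last by exists (v, w); rewrite ?inE.
have v_pq: v \in [set p; q] by rewrite -eq_vw set21.
have w_pq: w \in [set p; q] by rewrite -eq_vw set22.
have p_vw: p \in [set v; w] by rewrite eq_vw set21.
have q_vw: q \in [set v; w] by rewrite eq_vw set22.
move: v_pq w_pq p_vw q_vw pq; rewrite !inE /=.
do 2![case/pred2P => ->]; rewrite ?orbb.
- by move=> _ /eqP->.
- by [].
- by rewrite adj_sym.
- by move=> /eqP->.
Qed.

Lemma sum_edges (F : {set G} -> nat) :
  \sum_(a : edge_of G) F (val a) = \sum_(a in edges G) F a.
Proof. by rewrite (big_sub (edges G)). Qed.

Lemma card_edge (a : {set G}) : a \in edges G -> #|a| = 2.
Proof.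
case/imsetP=> [[p q] pq /= ->]; rewrite cards2; have -> // : p != q.
by apply: contraTneq pq => ->; rewrite inE /= adj_irrefl.
Qed.

Lemma sum_incident_edge (a : edge_of G) : \sum_v incident v a = 2.
Proof.
rewrite -[RHS](card_edge (valP a)) -sum1_card [RHS]big_mkcond /=.
by apply: eq_bigr => v _; rewrite /incident; case: (v \in _).
Qed.

(** An edge has two elements, so the only edge that can contain two distinct
vertices is the set of these two. *)
Lemma sum_incident_neq (v w : G) : v != w ->
  \sum_a incident v a * incident w a = adj v w.
Proof.
move=> vw; rewrite (sum_edges (fun a => (v \in a) * (w \in a))).
rewrite (eq_bigr (fun a => (a == [set v; w]) : nat)); last first.
  move=> a edge_a; rewrite mulnb; congr (nat_of_bool _).
  by rewrite eq_sym eqEcard cards2 vw (card_edge edge_a) andbT subUset !sub1set.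
rewrite -in_edges; have [edge_vw|/negP edge_vw] := boolP ([set v; w] \in edges G).
  by rewrite (bigD1 _ edge_vw) /= eqxx big1 // => a /andP[_ /negPf->].
by rewrite big1 // => a edge_a; case: eqP => // def_a; rewrite -def_a in edge_vw.
Qed.

(** The pairs of a vertex [w] and an edge [a] containing [v] and [w] are counted in
two ways: each edge through [v] has two ends, while each [w] other than [v]
contributes an edge when it is adjacent to [v]. *)
Lemma sum_incident v : \sum_a incident v a = degree v.
Proof.
have : \sum_w \sum_a incident v a * incident w a = (\sum_a incident v a).*2.
  rewrite exchange_big /= -muln2 big_distrl /=; apply: eq_bigr => a _.
  by rewrite -big_distrr /= sum_incident_edge.
rewrite (bigD1 v) //= -addnn => eq_sum.
have {}eq_sum : (\sum_a incident v a + degree v = \sum_a incident v a + \sum_a incident v a)%N.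
  rewrite -eq_sum; congr (_ + _)%N.
    by apply: eq_bigr => a _; rewrite mulnb andbb.
  rewrite degreeE (bigD1 v) //= adj_irrefl add0n.
  by apply: eq_bigr => w wv; rewrite sum_incident_neq // eq_sym.
by move/addnI: eq_sum.
Qed.

Variables (R : rcfType) (r : nat).
Hypothesis regG : forall v : G, degree v = r.

Lemma biregular_incident : biregular incident r 2.
Proof. by split=> [v|a]; rewrite ?sum_incident_edge // sum_incident. Qed.

Lemma biregular_incident_sym : biregular (fun a v => incident v a) 2 r.
Proof. by have [? ?] := biregular_incident. Qed.

Local Open Scope ring_scope.

(** This is [B *m B^T = r + A] for the vertex-edge incidence matrix [B]. *)
Lemma incidence_gram :
  gram R (fun a v => incident v a) = (2 * r%:R)%:M - r%:R *: norm_laplacian R G.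
Proof.
have -> : (2 * r%:R)%:M = r%:R%:M + r%:R%:M :> 'M[R]_#|G|.
  by rewrite -raddfD /= mulr_natl mulr2n.
rewrite -addrA -adj_mx_regular // /gram fmx_mul (fmx_scalar G).
apply/matrixP=> i j; rewrite !mxE; set v := enum_val i; set w := enum_val j.
under eq_bigr do rewrite -natrM; rewrite -natr_sum.
have [<-|vw] := eqVneq v w.
  rewrite adj_irrefl addr0 mulr1 -(regG v) -sum_incident; congr (_%:R).
  by apply: eq_bigr => a _; rewrite mulnb andbb.
by rewrite sum_incident_neq // mulr0 add0r.
Qed.

End Incidence.

(** * The two coronas *)

Lemma edge_corona_is_corona (G1 G2 G3 : sgraph) :
  is_corona (fun (a : edge_of G1) (v : G1) => incident v a) G2 G3 (edge_corona G1 G2 G3).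
Proof.
exists id; first by exists id.
by move=> [[v|a]|[[a u]|[v w]]] [[v'|a']|[[a' u']|[v' w']]] //=; rewrite eq_sym.
Qed.

Lemma vertex_corona_is_corona (G1 G2 G3 : sgraph) :
  is_corona (@incident G1) G2 G3 (vertex_corona G1 G2 G3).
Proof.
pose swap (S T : Type) (x : S + T) : T + S :=
  match x with inl s => inr s | inr t => inl t end.
exists (fun s => match s with inl y => inl (swap _ _ y) | inr t => inr t end).
  by exists (fun s => match s with inl y => inl (swap _ _ y) | inr t => inr t end) => -[[]|].
by move=> [[v|a]|[[a u]|[v w]]] [[v'|a']|[[a' u']|[v' w']]] //=; rewrite eq_sym.
Qed.

Theorem theorem4p1 (R : rcfType) (G1 G2 G3 H1 H2 H3 : sgraph)
  (rG1 : regular G1) (rG2 : regular G2) (rG3 : regular G3)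
  (rH1 : regular H1) (rH2 : regular H2) (rH3 : regular H3)
  (cosp1 : L_cospectral R G1 H1)
  (cosp2 : L_cospectral R G2 H2)
  (cosp3 : L_cospectral R G3 H3) :
  L_cospectral R (vertex_corona G1 G2 G3) (vertex_corona H1 H2 H3) /\
  L_cospectral R (edge_corona G1 G2 G3) (edge_corona H1 H2 H3).
Proof.
case: rG1 rH1 => [r regG] [s regH].
have [eq_n eq_r] := L_cospectral_regular regG regH cosp1.
move: regH; rewrite -eq_r => regH.
have eq_m : #|edge_of G1| = #|edge_of H1|.
  have := biregular_double_count (biregular_incident regG).
  rewrite eq_n (biregular_double_count (biregular_incident regH)).
  by move/eqP; rewrite eqn_pmul2r // => /eqP.
have eq_gram (a b : R) : (\det (a%:M - b *: gram R (fun e v => @incident G1 v e))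
              = \det (a%:M - b *: gram R (fun e v => @incident H1 v e)))%R.
  rewrite (incidence_gram _ regG) (incidence_gram _ regH).
  have pencil n (L : 'M[R]_n) : (a%:M - b *: ((2 * r%:R)%:M - r%:R *: L)
      = (a - b * (2 * r%:R))%:M + (b * r%:R) *: L)%R.
    by rewrite scalerBr opprB scale_scalar_mx scalerA raddfB /= addrA addrAC.
  by rewrite !pencil; apply: det_pencil_char_poly.
split.
- apply: (L_cospectral_corona (biregular_incident regG) (biregular_incident regH)
    eq_n eq_m rG2 rH2 cosp2 rG3 rH3 cosp3 _
    (@vertex_corona_is_corona _ _ _) (@vertex_corona_is_corona _ _ _)) => a b a0.
  have gram_swap (G : sgraph) : (\det (a%:M - b *: gram R (@incident G)) * a ^+ #|G|
      = \det (a%:M - b *: gram R (fun e v => @incident G v e)) * a ^+ #|edge_of G|)%R.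
    exact: det_1subC.
  by apply: (mulIf (expf_neq0 #|G1| a0)); rewrite [in RHS]eq_n !gram_swap eq_gram eq_m.
- apply: (L_cospectral_corona (biregular_incident_sym regG) (biregular_incident_sym regH)
    eq_m eq_n rG2 rH2 cosp2 rG3 rH3 cosp3 _
    (@edge_corona_is_corona _ _ _) (@edge_corona_is_corona _ _ _)) => a b _.
  exact: eq_gram.
Qed.
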